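(* Let $K=\bigcup_{t\in T}A_t\cup B\cup C$ be any basic space with associated sets $C_x$ ($x\in B$) and function $\psi:B\to G^T$, and let $\mathbb{L}_1\subset L\times[0,1]^B$ be the compact space constructed from it as described in the context. Then $\mathbb{L}_1$ is not weakly Radon-Nikodým.
   Context: Compact spaces are Hausdorff. $\mathbb{N}=\{1,2,\dots\}$. A compact space is weakly Radon-Nikodým (WRN) if it is homeomorphic to a weak$^*$-compact subset of the dual of a Banach space which does not contain an isomorphic copy of $\ell_1$. $\Delta=\{0,1\}^{\mathbb{N}}$ is the Cantor set with its product topology; $0\in\Delta$ is the constant zero sequence. $T=2^{<\omega}$ is the set of all finite sequences of 0's and 1's, $|t|$ is the length of $t\in T$, and $^\frown$ denotes concatenation. $G$ is the set of all (nonempty) finite sets $g=\{s_1,\dots,s_n\}\subset T$ with $|s_1|=\dots=|s_n|$. For $t\in T$, $g\in G$ define the continuous map $\Gamma_g^t:\Delta\to\Delta$ by $\Gamma_g^t(s^\frown\lambda)=t^\frown\lambda$ if $s\in g$ and $\lambda\in\Delta$, and $\Gamma_g^t(z)=t^\frown(0,0,\dots)$ for all other points $z\in\Delta$. A basic space is a compact space $K=\bigcup_{t\in T}A_t\cup B\cup C$ (the sets $A_t$, $t\in T$, and $B$, $C$ being pairwise disjoint), with $A=\bigcup_{t\in T}A_t$, such that: (1) all points of $A$ are isolated in $K$; (2) for every $x\in B$ there is an infinite set $C_x\subset A$ such that $\overline{C_x}=C_x\cup\{x\}$ and $\overline{C_x}$ is open in $K$; (3) there is a function $\psi:B\to G^T$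 (write $\psi(x)[t]\in G$ for the $t$-th coordinate of $\psi(x)$) such that for any family $\{X_g^t:g\in G,\,t\in T\}$ of subsets of $A$ with $A_t=\bigcup_{g\in G}X_g^t$ for every $t\in T$, there exists $x\in B$ such that $C_x\cap X^t_{\psi(x)[t]}$ is infinite for all $t\in T$. Given a basic space with fixed choice of the $C_x$ and $\psi$, let $L=(A\times\Delta)\cup B\cup C$ with the following topology: basic neighborhoods of $(a,z)\in A\times\Delta$ are the sets $\{a\}\times U$ with $U$ a neighborhood of $z$ in $\Delta$; basic neighborhoods of $x\in B\cup C$ are the sets $((U\cap A)\times\Delta)\cup(U\setminus A)$ with $U$ a neighborhood of $x$ in $K$. Let $q:\Delta\to[0,1]$, $q(t_1,t_2,\dots)=\sum_{k\in\mathbb{N}}t_k2^{-k}$. For $x\in B$ let $g_x:L\setminus\{x\}\to\Delta$ be the continuous function given by $g_x(a,z)=\Gamma^t_{\psi(x)[t]}(z)$ if $a\in A_t\cap C_x$ and $z\in\Delta$, and $g_x(y)=0$ in any other case; let $f_x=q\circ g_x:L\setminus\{x\}\to[0,1]$. Finally $$\mathbb{L}_1=\{[u,v]\in L\times[0,1]^B:\ f_x(u)=v_x\text{ for all }x\in B\setminus\{u\}\},$$ with the subspace topology of the product $L\times[0,1]^B$. *)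

(* Defs.v *)
From HB Require Import structures.
From mathcomp Require Import all_boot all_order all_algebra.
From mathcomp Require Import finmap.
From mathcomp Require Import all_classical all_reals all_analysis.

Set Implicit Arguments.
Unset Strict Implicit.
Unset Printing Implicit Defensive.

Import Order.TTheory GRing.Theory Num.Theory.
Import numFieldNormedType.Exports.

Local Open Scope classical_set_scope.
Local Open Scope ring_scope.

Definition homeomorphic (X Y : topologicalType) : Prop :=
  exists (f : X -> Y) (g : Y -> X),
    [/\ cancel f g, cancel g f, continuous f & continuous g].

Definition ell1 (R : realType) : set (R^nat) :=
  [set a : R^nat | cvgn (series (fun n => `|a n|))].

Definition ell1_norm (R : realType) (a : R^nat) : R :=
  limn (series (fun n => `|a n|)).

(* J is only constrained on ell1: its restriction to ell1 is a linear
   isomorphism onto its image. *)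
Definition contains_ell1 (R : realType) (E : normedModType R) : Prop :=
  exists J : R^nat -> E,
    (forall (k : R) (a b : R^nat), ell1 a -> ell1 b ->
       J (fun n => k * a n + b n) = k *: J a + J b) /\
    exists c C : R, [/\ 0 < c, 0 < C & forall a : R^nat, ell1 a ->
       c * ell1_norm a <= `|J a| /\ `|J a| <= C * ell1_norm a].

(* As a subset of {ptws E -> R}, the dual carries its weak-star topology. *)
Definition weak_star_dual (R : realType) (E : normedModType R) :
    set {ptws E -> R} :=
  [set f | (forall (k : R) (u v : E), f (k *: u + v) = k * f u + f v) /\
           continuous (f : E -> R)].

Arguments weak_star_dual : clear implicits.

Definition weakly_Radon_Nikodym (R : realType) (X : topologicalType) : Prop :=
  exists E : completeNormedModType R, ~ contains_ell1 E /\
    exists S : set {ptws E -> R},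
      [/\ S `<=` weak_star_dual R E, compact S & homeomorphic X (set_type S)].

(* Infinite sequences are indexed from 0 here: the coordinate written t_k,
   k >= 1, in the mathematics is z k.-1. *)
Notation Delta := cantor_space.

Definition zeroD : Delta := fun=> false.

Definition catD (t : bitseq) (z : Delta) : Delta :=
  fun n => if (n < size t)%N then nth false t n else z (n - size t)%N.

Definition dropD (n : nat) (z : Delta) : Delta := fun k => z (n + k)%N.

Record level_set := LevelSet {
  level_fset :> {fset bitseq};
  level_set_neq0 : level_fset != fset0;
  level_set_size : forall s s', s \in level_fset -> s' \in level_fset ->
    size s = size s' }.

(* The filtered sequence lists the elements of g that are initial segments of
   z; all elements of g having the same length, there is at most one. *)
Definition Gamma (t : bitseq) (g : level_set) (z : Delta) : Delta :=
  if [seq s <- enum_fset g | s == mkseq z (size s)] is s :: _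
  then catD t (dropD (size s) z)
  else catD t zeroD.

Definition qD (R : realType) (z : Delta) : R :=
  limn (series (fun k => (z k)%:R / 2%:R ^+ k.+1 : R)).

Record basic_space := BasicSpace {
  bsp :> topologicalType;
  bsA_ : bitseq -> set bsp;
  bsB : set bsp;
  bsC : set bsp;
  bsA : set bsp := \bigcup_t bsA_ t;
  bsCx : set_type bsB -> set bsp;
  bspsi : set_type bsB -> bitseq -> level_set;
  bs_compact : compact [set: bsp];
  bs_hausdorff : hausdorff_space bsp;
  bs_cover : bsA `|` bsB `|` bsC = [set: bsp];
  bs_trivIset : trivIset [set: bitseq] bsA_;
  bs_disjAB : bsA `&` bsB = set0;
  bs_disjAC : bsA `&` bsC = set0;
  bs_disjBC : bsB `&` bsC = set0;
  bs_isolated : forall a, bsA a -> open [set a];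
  bs_Cx : forall x : set_type bsB,
    [/\ bsCx x `<=` bsA, infinite_set (bsCx x),
        closure (bsCx x) = bsCx x `|` [set \val x] & open (closure (bsCx x))];
  bs_psi : forall X : level_set -> bitseq -> set bsp,
    (forall g t, X g t `<=` bsA) ->
    (forall t, bsA_ t = \bigcup_g X g t) ->
    exists x : set_type bsB,
      forall t, infinite_set (bsCx x `&` X (bspsi x t) t) }.

Arguments bsA_ : clear implicits.
Arguments bsA : clear implicits.
Arguments bsB : clear implicits.
Arguments bsC : clear implicits.

Inductive Lspc (K : basic_space) : Type :=
  | Lpair of set_type (bsA K) & Delta
  | LB of set_type (bsB K)
  | LC of set_type (bsC K).

Arguments Lpair {K}.
Arguments LB {K}.
Arguments LC {K}.

Section Ltopology.
Variable K : basic_space.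

Definition Lproj (u : Lspc K) : K :=
  match u with Lpair a _ => \val a | LB x => \val x | LC x => \val x end.

(* The preimage of U under Lproj is ((U `&` A) x Delta) `|` (U `\` A). *)
Definition Lbasic_nbhs (u : Lspc K) : set_system (Lspc K) :=
  match u with
  | Lpair a z => [set V | exists2 U, nbhs z U & V = Lpair a @` U]
  | _ => [set V | exists2 U, nbhs (Lproj u) U & V = Lproj @^-1` U]
  end.

Definition Lopen : set_system (Lspc K) :=
  [set W | forall u, W u -> exists2 V, Lbasic_nbhs u V & V `<=` W].

Let LbasicI (u : Lspc K) (V W : set (Lspc K)) :
  Lbasic_nbhs u V -> Lbasic_nbhs u W -> Lbasic_nbhs u (V `&` W).
Proof.
case: u => [a z|x|x] [U nU ->] [U' nU' ->]; exists (U `&` U');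
  do ?exact: filterI; rewrite ?preimage_setI//.
apply/seteqP; split=> [_ [[y Uy <-] [y' Uy' [yy']]]|_ [y [Uy Uy'] <-]].
  by exists y => //; split=> //; rewrite -yy'.
by split; exists y.
Qed.

Let Lbasic_nonempty (u : Lspc K) : exists V, Lbasic_nbhs u V.
Proof.
by case: u => [a z|x|x]; eexists; exists setT; do ?exact: filterT.
Qed.

Let LopenT : Lopen setT.
Proof. by move=> u _; have [V uV] := Lbasic_nonempty u; exists V. Qed.

Let LopenI (V W : set (Lspc K)) : Lopen V -> Lopen W -> Lopen (V `&` W).
Proof.
move=> oV oW u [/oV[V' uV' VV'] /oW[W' uW' WW']].
by exists (V' `&` W'); [exact: LbasicI | exact: setISS].
Qed.

Let Lopen_bigU (I : Type) (W : I -> set (Lspc K)) :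
  (forall i, Lopen (W i)) -> Lopen (\bigcup_i W i).
Proof.
move=> oW u [i _ /oW[V uV VW]]; exists V => //.
by move=> v /VW Wv; exists i.
Qed.

HB.instance Definition _ := gen_eqMixin (Lspc K).
HB.instance Definition _ := gen_choiceMixin (Lspc K).
HB.instance Definition _ :=
  isOpenTopological.Build (Lspc K) LopenT LopenI Lopen_bigU.

Lemma Lspc_nbhsE (u : Lspc K) (W : set (Lspc K)) :
  nbhs u W <-> exists2 V, Lbasic_nbhs u V & V `<=` W.
Proof.
have LopenE V : Lopen V -> open V by [].
rewrite nbhsE; split=> [[D [oD Du] DW]|[V]].
  have [V uV VD] := oD u Du.
  by exists V => //; exact: subset_trans DW.
case: u => [a z|x|x] [U + ->] UW; rewrite nbhsE => -[D [oD Dz] DU].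
- exists (Lpair a @` D); last by apply: subset_trans UW; exact: image_subset.
  split; last by exists z.
  move=> _ [z' Dz' <-]; exists (Lpair a @` D) => //.
  by exists D => //; exact: open_nbhs_nbhs.
all: exists (Lproj @^-1` D); last by move=> y /DU/UW.
all: split=> //; apply: LopenE => -[a z|y|y] Dy.
1,4: exists (Lpair a @` setT) => [|_ [z' _ <-]//].
1,2: by exists setT => //; exact: filterT.
all: by exists (Lproj @^-1` D) => //; exists D => //; exact: open_nbhs_nbhs.
Qed.

End Ltopology.

(* The index t with a \in A_t; it is unique as the A_t are disjoint. *)
Definition Aindex (K : basic_space) (a : set_type (bsA K)) : bitseq :=
  xget [::] [set t | bsA_ K t (\val a)].

Definition gL (K : basic_space) (x : set_type (bsB K)) (u : Lspc K) : Delta :=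
  if u is Lpair a z then
    if `[< bsCx x (\val a) >] then Gamma (Aindex a) (bspsi x (Aindex a)) z
    else zeroD
  else zeroD.

Definition fL (R : realType) (K : basic_space) (x : set_type (bsB K))
  (u : Lspc K) : R := qD R (gL x u).

Notation unit_segment R := (set_type (`[0%R, 1%R] : set R)).

Definition L1set (R : realType) (K : basic_space) :
    set (Lspc K * {ptws set_type (bsB K) -> unit_segment R}) :=
  [set w | forall x : set_type (bsB K),
     LB x <> w.1 -> fL R x w.1 = \val (w.2 x)].

Definition L1 (R : realType) (K : basic_space) : topologicalType :=
  set_type (@L1set R K).

(* Main.v *)
(* Let h embed the space into a weak-star compact subset of E^*, bounded by M.  For each a in A,
   the functions z |-> h(a,z)(u), |u| <= 1, form a bounded family of continuous functions on the
   Cantor set containing no l1-sequence, so by a Rosenthal-type argument for every e > 0 there is m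
   such that each u in the unit ball has some s in {0,1}^m at which the values at s000... and s111...
   differ by at most e.  Let X_g^t be the set of a in A_t for which s can always be found in g, with
   e = 4^-|t|.  For the point x given by (3), the points (a, s^z), a in C_x, converge to
   [x, q(t^z)] for every s in psi(x)[t]; hence the values of h(.)(u) at [x, q(t000...)] and
   [x, q(t111...)] differ by at most 4^-|t|, for all t.  Summing over the 2^n dyadic intervals of
   length 2^-n, h does not separate [x, 0] from [x, 1]. *)
Require Import Defs.
From HB Require Import structures.
From mathcomp Require Import all_boot all_order all_algebra.
From mathcomp Require Import finmap.
From mathcomp Require Import all_classical all_reals all_analysis.
From mathcomp Require Import ring lra.
Set Implicit Arguments.
Unset Strict Implicit.
Unset Printing Implicit Defensive.

Import Order.TTheory GRing.Theory Num.Theory.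
Import numFieldNormedType.Exports.

Local Open Scope classical_set_scope.
Local Open Scope ring_scope.

(** * Functions satisfying the linearity identity *)

Section linear_functions.
Variables (R : pzRingType) (U V : lmodType R) (f : U -> V).
Hypothesis linf : linear f.

Lemma linear_fun0 : f 0 = 0.
Proof.
have := linf 1 0 0; rewrite !scale1r addr0 => /eqP.
by rewrite -subr_eq0 opprD addNKr oppr_eq0 => /eqP.
Qed.

Lemma linear_funZ k u : f (k *: u) = k *: f u.
Proof. by rewrite -[k *: u]addr0 linf linear_fun0 addr0. Qed.
End linear_functions.

(** * Extraction of an independent sequence of pairs of sets *)

Section independence.
Variables (T : topologicalType) (I : finType) (V : I -> nat -> bool -> set T).

(** In the application [i] numbers finitely many thresholds, and [V i n true], [V i n false] are the
    sets where the n-th function lies above, respectively below, the gap at the i-th threshold. *)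
Definition splits (i : I) (n : nat) (U : set T) :=
  forall b, U `&` V i n b !=set0.

Lemma splitsS i n U U' : U `<=` U' -> splits i n U -> splits i n U'.
Proof. by move=> UU' + b => /(_ b)[z [Uz Vz]]; exists z; split=> //; exact: UU'. Qed.

Fixpoint cell (U : set T) (i : I) (ns : seq nat) (sg : bitseq) : set T :=
  match ns, sg with
  | n :: ns', b :: sg' => cell U i ns' sg' `&` V i n b
  | _, _ => U
  end.

Hypothesis openV : forall i n b, open (V i n b).

Hypothesis splitV : forall U, open U -> U !=set0 ->
  \forall n \near \oo, exists i, splits i n U.

(* Along an ultrafilter F, the set of colours i with F(splits i ^~ U) shrinks with U, and is never
   empty as there are finitely many colours; take U with the least number of them. *)
Lemma eventually_split_color (z : T) : exists F : set_system nat,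
  ProperFilter F /\ exists i U, [/\ open U, U !=set0 &
    forall U', open U' -> U' !=set0 -> U' `<=` U -> F (splits i ^~ U')].
Proof.
have [F [FU Foo]] := @ultraFilterLemma nat \oo _.
have FF : ProperFilter F := @ultra_proper _ _ FU.
exists F; split=> //.
pose col U : {set I} := [set i | `[< F (splits i ^~ U) >]]%SET.
have colP i U : reflect (F (splits i ^~ U)) (i \in col U).
  by rewrite inE; apply: asboolP.
have colS U U' : U `<=` U' -> col U \subset col U'.
  move=> UU'; apply/fintype.subsetP => i /colP FU1; apply/colP.
  by apply: filterS FU1 => n; exact: splitsS.
have [m [U [oU U0 Um]] mmin] : exists2 m, (exists U, [/\ open U, U !=set0 & #|col U| = m])
    & forall U, open U -> U !=set0 -> (m <= #|col U|)%N.
  have ex : exists m, `[< exists U, [/\ open U, U !=set0 & #|col U| = m] >].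
    exists #|col setT|; apply/asboolP; exists setT; split=> //; first exact: openT.
    by exists z.
  case: (ex_minnP ex) => m /asboolP Um mmin; exists m => // U oU U0.
  by apply: mmin; apply/asboolP; exists U.
have colE U' : open U' -> U' !=set0 -> U' `<=` U -> col U' = col U.
  move=> oU' U'0 U'U; apply/eqP; rewrite eqEcard colS//= Um.
  exact: mmin.
have [i iU] : exists i, i \in col U.
  apply: contrapT => nex.
  have Fn i : F (~` (splits i ^~ U)).
    have [Fi|//] := in_ultra_setVsetC (splits i ^~ U) FU.
    by case: nex; exists i; apply/colP.
  have /filter_ex[n [[i]] ] : F ([set n | exists i, splits i n U] `&`
                              [set n | forall i, ~ splits i n U]).
    apply: filterI; first exact/Foo/splitV.
    exact: filter_forall.
  by move=> + nsp; exact: nsp.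
exists i, U; split=> // U' oU' U'0 U'U.
by apply/colP; rewrite colE.
Qed.

Lemma cell_subset U i ns sg : cell U i ns sg `<=` U.
Proof. by elim: ns sg => [|n ns IH] [|b sg]//= z [/IH]. Qed.

Lemma open_cell U i ns sg : open U -> open (cell U i ns sg).
Proof.
by move=> oU; elim: ns sg => [|n ns IH] [|b sg]//=; apply: openI.
Qed.

(** Indices are chosen one after the other inside the open set [U] of [eventually_split_color]. The
    cells cut out so far are finitely many nonempty open subsets of [U]; each is split by [F]-many
    [n], hence some [n] splits them all at once. *)
Lemma independent_subsequence (z0 : T) : exists i (n_ : nat -> nat),
  forall k (sg : nat -> bool), exists z, forall j, (j < k)%N -> V i (n_ j) (sg j) z.
Proof.
have [F [FF [i [U [oU U0 FU]]]]] := eventually_split_color z0.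
pose good ns := forall sg, size sg = size ns -> cell U i ns sg !=set0.
(* Goodness is a premise under the existential, so that [choice] yields a function defined on all
   lists. *)
have step ns : exists n, good ns -> good (n :: ns).
  have [gns|] := pselect (good ns); last by exists 0%N.
  have /filter_ex[n nP] :
      F [set n | forall sg : (size ns).-tuple bool, splits i n (cell U i ns sg)].
    apply: filter_forall => sg; apply: FU; first exact: open_cell.
      by apply: gns; rewrite size_tuple.
    exact: cell_subset.
  exists n => _ [//|b sg] [] /eqP ssg /=.
  exact: (nP (Tuple ssg)).
have [f fP] := choice step.
pose S k := iter k (fun ns => f ns :: ns) [::].
have gS k : good (S k) by elim: k => [|k IH] /=; [|exact: fP].
have sS k : size (S k) = k by elim: k => //= k ->.
exists i, (f \o S) => k sg.
(* Signs are listed latest first, as [S] puts each new index in front. *)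
pose sgs := fix sgs k := if k is k'.+1 then sg k' :: sgs k' else [::].
have ssg k' : size (sgs k') = k' by elim: k' => //= k' ->.
have [z Cz] := gS k (sgs k) (etrans (ssg k) (esym (sS k))).
exists z; elim: k Cz => [//|k IH] /= [Cz Vz] j.
by rewrite ltnS leq_eqVlt => /predU1P[->|]//; exact: IH.
Qed.
End independence.

(** * From independent functionals to a copy of l1 *)

Section rosenthal.
Variables (R : realType) (E : completeNormedModType R) (T : Type).
Variables (F : T -> E -> R) (M : R).
Hypothesis M0 : 0 < M.
Hypothesis linF : forall z, linear (F z : E -> R^o).
Hypothesis leF : forall z u, `|F z u| <= M * `|u|.

Lemma functional_sum z (u : nat -> E) (a : nat -> R) n :
  F z (series (fun k => a k *: u k) n) = series (fun k => a k * F z (u k)) n.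
Proof.
rewrite /series /=; elim: n => [|n IH]; first by rewrite !big_geq// (linear_fun0 (linF z)).
by rewrite !big_nat_recr//= -IH addrC linF addrC.
Qed.

(* Take z for the signs of a and z' for the opposite signs: the j-th terms of F z v and F z' v
   differ by at least d |a_j|, so one of the two is at least d/2 times the l1-norm of a. *)
Lemma independent_ge (u : nat -> E) (p d : R) (a : nat -> R) n : 0 < d ->
  (forall sg : nat -> bool, exists z, forall j, (j < n)%N ->
     if sg j then p + d < F z (u j) else F z (u j) < p) ->
  d / (2 * M) * series (fun k => `|a k|) n <= `|series (fun k => a k *: u k) n|.
Proof.
move=> d0 H; set v : E := series (fun k => a k *: u k) n.
have [z zP] := H (fun j => 0 <= a j).
have [z' z'P] := H (fun j => ~~ (0 <= a j)).
have : d * series (fun k => `|a k|) n <= F z v - F z' v.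
  rewrite !functional_sum /series /= -sumrB mulr_sumr.
  rewrite big_nat_cond [leRHS]big_nat_cond; apply: ler_sum => j.
  rewrite andbT => jn; move: (zP j jn) (z'P j jn).
  case: (lerP 0 (a j)) => aj /=.
    rewrite ger0_norm// => h1 h2; rewrite -mulrBr mulrC ler_wpM2l//; lra.
  rewrite ltr0_norm// => h1 h2; rewrite -mulrBr mulrC.
  rewrite -[leRHS]mulrNN ler_wpM2l//; lra.
have := leF z v; have := leF z' v.
rewrite mulrAC ler_pdivrMr ?mulr_gt0// !ler_norml.
by move=> /andP[h1 h2] /andP[h3 h4] h5; lra.
Qed.

Lemma normed_scale_le (u : nat -> E) (a : nat -> R) n : (forall n, `|u n| <= 1) ->
  `|a n *: u n| <= `|a n|.
Proof. by move=> u1; rewrite normrZ -[leRHS]mulr1 ler_wpM2l. Qed.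

Lemma abs_cvg_series (u : nat -> E) (a : nat -> R) : (forall n, `|u n| <= 1) ->
  ell1 a -> cvgn [normed series (fun k => a k *: u k)].
Proof.
by move=> u1 a1; apply: series_le_cvg a1 => n //=; exact: normed_scale_le.
Qed.

(** The embedding sends [a] to the sum of the [a k *: u k], which converges absolutely in the
    complete space [E]. The upper bound is the triangle inequality; the lower one is
    [independent_ge] in the limit. *)
Lemma independent_contains_ell1 (u : nat -> E) (p d : R) : 0 < d ->
  (forall n, `|u n| <= 1) ->
  (forall n (sg : nat -> bool), exists z, forall j, (j < n)%N ->
     if sg j then p + d < F z (u j) else F z (u j) < p) ->
  contains_ell1 E.
Proof.
move=> d0 u1 H.
exists (fun a => limn (series (fun k => a k *: u k))); split.
  move=> k a b /(abs_cvg_series u1)/normed_cvg ca /(abs_cvg_series u1)/normed_cvg cb.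
  rewrite -(limZl_tmp k ca) -limD//; last exact: is_cvgZl_tmp.
  congr (limn _); apply/funext => n; rewrite !fctE /series /=.
  rewrite scaler_sumr -big_split/=; apply: eq_bigr => i _.
  by rewrite scalerDl scalerA.
exists (d / (2 * M)), 1; split; rewrite ?ltr01 ?divr_gt0 ?mulr_gt0// => a a1.
have cna := abs_cvg_series u1 a1.
have ca := normed_cvg cna.
have cn := cvg_norm (FF := eventually_filter) ca.
split.
  have cl : (fun n => d / (2 * M) * series (fun k => `|a k|) n) @ \oo -->
      d / (2 * M) * ell1_norm a by apply: (@cvgZl_tmp _ R^o).
  rewrite -(cvg_lim _ cl)// -(cvg_lim _ cn)//.
  apply: ler_lim; [by apply/cvg_ex; eexists; exact: cl
                  |by apply/cvg_ex; eexists; exact: cn|].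
  by apply: nearW => n; exact: independent_ge.
rewrite mul1r.
apply: le_trans (lim_series_norm cna) _.
by apply: lim_series_le => // n; exact: normed_scale_le.
Qed.
End rosenthal.

(** * Convergence in products and subspaces *)

Lemma prod_topology_cvg (I : Type) (T : I -> topologicalType)
    (F : set_system (prod_topology T)) (f : prod_topology T) : Filter F ->
  (forall i, (fun g : prod_topology T => g i) @ F --> f i) -> F --> f.
Proof.
move=> FF H; apply/cvg_sup => i A.
rewrite (@nbhsE (initial_topology (fun g : prod_topology T => g i))).
move=> [B [[C oC <-] Cf] /filterS]; apply.
by apply: (H i); exact: open_nbhs_nbhs.
Qed.

Lemma set_type_cvg (T : topologicalType) (A : set T) (F : set_system (set_type A))
    (x : set_type A) : Filter F -> set_val @ F --> set_val x -> F --> x.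
Proof.
move=> FF H B; rewrite nbhsE => -[_ [[C oC <-] Cx] /filterS]; apply.
by apply: H; exact: open_nbhs_nbhs.
Qed.

Lemma set_val_continuous (T : topologicalType) (A : set T) :
  continuous (set_val : set_type A -> T).
Proof. exact: initial_continuous. Qed.

(** * The Cantor set, binary expansions and the maps Gamma *)

Definition oneD : Delta := fun=> true.

Lemma catD_cons b t z : catD (b :: t) z = catD [:: b] (catD t z).
Proof.
apply/funext => -[|n]; first by [].
by rewrite [RHS]/catD /= subn1 /catD /= subSS ltnS.
Qed.

(** With [catD_rcons1]: the endpoints of the dyadic interval of [t] are the outer endpoints of its
    two halves. *)
Lemma catD_rcons0 t : catD (rcons t false) zeroD = catD t zeroD.
Proof.
apply/funext => n; rewrite /catD size_rcons nth_rcons ltnS.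
by case: ltngtP => // _; rewrite /zeroD.
Qed.

Lemma catD_rcons1 t : catD (rcons t true) oneD = catD t oneD.
Proof.
apply/funext => n; rewrite /catD size_rcons nth_rcons ltnS.
by case: ltngtP => // _; rewrite /oneD.
Qed.

(** The cylinders around [z] generate a filter converging to [z] in every coordinate, hence finer
    than [nbhs z]. *)
Lemma Delta_nbhsP (z : Delta) (U : set Delta) : nbhs z U ->
  exists N, forall w : Delta, (forall k, (k < N)%N -> w k = z k) -> U w.
Proof.
pose F : set_system Delta := filter_from setT
  (fun N => [set w | forall k, (k < N)%N -> w k = z k]).
have FF : Filter F.
  apply: filter_from_filter; first by exists 0%N.
  move=> i j _ _; exists (maxn i j) => // w H; split=> k kij; apply: H;
  by rewrite leq_max kij ?orbT.
move=> nU; have : F --> z.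
  apply: prod_topology_cvg => k A Az; exists k.+1 => // w H.
  by rewrite /= H//; exact: nbhs_singleton.
by move=> /(_ U nU)[N _ NU]; exists N.
Qed.

Lemma coord_near (z : Delta) k : \forall w \near z, w k = z k.
Proof.
by apply: (@proj_continuous nat (fun=> bool) k z [set b | b = z k]).
Qed.

Lemma coords_near (z : Delta) N : \forall w \near z, forall k, (k < N)%N -> w k = z k.
Proof.
elim: N => [|N IH]; first exact: filterE.
apply: filterS2 IH (coord_near z N) => w wN wz k.
by rewrite ltnS leq_eqVlt => /predU1P[->|/wN].
Qed.

Section binary.
Variable R : realType.
Local Notation q := (@qD R).

Definition q_part (z : Delta) (n : nat) : R :=
  series (fun k => (z k)%:R / 2%:R ^+ k.+1 : R) n.

(** Self-similarity under the shift, the source of the bounds, the endpoint values and the modulus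
    of continuity of q. *)
Lemma q_partS z n : q_part z n.+1 = (z 0%N)%:R / 2 + q_part (dropD 1 z) n / 2.
Proof.
rewrite /q_part /series /= big_nat_recl// expr1; congr (_ + _).
rewrite mulr_suml; apply: eq_bigr => k _.
by rewrite /dropD add1n exprS invfM mulrA mulrAC.
Qed.

Lemma q_part_itv z n : 0 <= q_part z n <= 1.
Proof.
elim: n z => [|n IH] z; first by rewrite /q_part /series /= big_geq// lexx ler01.
rewrite q_partS; move: (IH (dropD 1 z)).
by case: (z 0%N) => /= /andP[? ?]; apply/andP; split; lra.
Qed.

Lemma q_part_cvg z : cvgn (q_part z).
Proof.
apply: nondecreasing_is_cvgn.
  apply/nondecreasing_seqP => n; rewrite /q_part /series /= big_nat_recr//=.
  by rewrite lerDl divr_ge0// exprn_ge0.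
by exists 1 => _ [n _ <-]; have /andP[] := q_part_itv z n.
Qed.

Lemma qD_itv z : 0 <= q z <= 1.
Proof.
apply/andP; split.
  by apply: limr_ge; [exact: q_part_cvg|apply: nearW => n; have /andP[] := q_part_itv z n].
by apply: limr_le; [exact: q_part_cvg|apply: nearW => n; have /andP[] := q_part_itv z n].
Qed.

Lemma qD_rec z : q z = (z 0%N)%:R / 2 + q (dropD 1 z) / 2.
Proof.
have h : cvgn (q_part (dropD 1 z)) by exact: q_part_cvg.
have : q_part z n.+1 @[n --> \oo] --> (z 0%N)%:R / 2 + q (dropD 1 z) / 2.
  under eq_fun do rewrite q_partS.
  by apply: cvgD; [exact: cvg_cst|apply: cvgM => //; exact: cvg_cst].
by rewrite (cvg_shiftS (q_part z)) => /cvg_lim <-.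
Qed.

Lemma qD_cons b z : q (catD [:: b] z) = b%:R / 2 + q z / 2.
Proof.
rewrite qD_rec; congr (_ + q _ / 2).
by apply/funext => n; rewrite /dropD /catD /= add1n subSS subn0.
Qed.

(** [zeroD], like [oneD] below, is fixed by the shift, so [qD_rec] becomes a linear equation for its
    value. *)
Lemma qD_zero : q zeroD = 0.
Proof.
have := qD_rec zeroD; rewrite (_ : dropD 1 zeroD = zeroD)//= => h; lra.
Qed.

Lemma qD_one : q oneD = 1.
Proof.
have := qD_rec oneD; rewrite (_ : dropD 1 oneD = oneD)//= => h; lra.
Qed.

(** These are the two binary expansions of the common endpoint of the two halves of the dyadic
    interval of [t]. *)
Lemma qD_adjacent t : q (catD (rcons t false) oneD) = q (catD (rcons t true) zeroD).
Proof.
elim: t => [|b t IH] /=.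
  by rewrite !qD_cons qD_one qD_zero /=; lra.
by rewrite (catD_cons b (rcons _ false)) (catD_cons b (rcons _ true)) !qD_cons IH.
Qed.

Lemma qD_agree N z w : (forall k, (k < N)%N -> w k = z k) -> `|q z - q w| <= 2 ^- N.
Proof.
elim: N z w => [|N IH] z w H.
  rewrite expr0 invr1; move: (qD_itv z) (qD_itv w) => /andP[? ?] /andP[? ?].
  by rewrite ler_norml; apply/andP; split; lra.
rewrite (qD_rec z) (qD_rec w) H//.
have := IH (dropD 1 z) (dropD 1 w) (fun k kN => H k.+1 kN).
by rewrite exprS invfM !ler_norml => /andP[? ?]; apply/andP; split; lra.
Qed.

Lemma qD_continuous : continuous q.
Proof.
move=> z; apply/cvgrPdist_le => /= e e0.
have [N Ne] : exists N, 2 ^- N <= e.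
  have /cvgrPdist_le/(_ e e0)[N _ /(_ N (leqnn N))] : (2^-1 : R) ^+ n @[n --> \oo] --> (0 : R).
    by apply: cvg_expr; rewrite ger0_norm ?invr_ge0// invf_lt1// ltr1n.
  by rewrite sub0r normrN exprVn ger0_norm ?invr_ge0 ?exprn_ge0//; exists N.
near=> w; apply: le_trans Ne; apply: qD_agree.
by near: w; exact: coords_near.
Unshelve. all: by end_near. Qed.

End binary.

Lemma catD_mkseq_agree (z w : Delta) n k : (k < n)%N -> catD (mkseq z n) w k = z k.
Proof. by move=> kn; rewrite /catD size_mkseq kn nth_mkseq. Qed.

Lemma mkseq_catD s z : mkseq (catD s z) (size s) = s.
Proof.
apply: (@eq_from_nth _ false); rewrite size_mkseq// => k ks.
by rewrite nth_mkseq// /catD ks.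
Qed.

Lemma dropD_catD s z : dropD (size s) (catD s z) = z.
Proof.
by apply/funext => k; rewrite /dropD /catD ltnNge leq_addr /= addKn.
Qed.

(** All elements of [g] have the length of [s], so the only one that is an initial segment of
    [catD s z] is [s] itself. *)
Lemma Gamma_catD t (g : level_set) s z : s \in level_fset g ->
  Gamma t g (catD s z) = catD t z.
Proof.
move=> sg; rewrite /Gamma.
case E : [seq _ <- _ | _] => [|s' l].
  have : s \in [seq s' <- enum_fset g | s' == mkseq (catD s z) (size s')].
    by rewrite mem_filter mkseq_catD eqxx.
  by rewrite E.
have : s' \in [seq s' <- enum_fset g | s' == mkseq (catD s z) (size s')].
  by rewrite E mem_head.
rewrite mem_filter => /andP[/eqP s'E s'g].
rewrite (level_set_size s'g sg) mkseq_catD in s'E.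
by rewrite s'E dropD_catD.
Qed.

Lemma Gamma_continuous t g : continuous (Gamma t g).
Proof.
move=> z; apply: prod_topology_cvg => k A Az /=.
have [s0 s0g] := fset0Pn _ (level_set_neq0 g).
(* The first [size s0] digits decide which element of [g] matches; the following [k.+1] cover the
   digit that the shift moves to place [k]. *)
have := coords_near z (size s0 + k.+1).
apply: filterS => w wz; rewrite /=.
suff -> : Gamma t g w k = Gamma t g z k by exact: nbhs_singleton.
have -> : Gamma t g w = if [seq s <- enum_fset g | s == mkseq z (size s)] is s :: _
  then catD t (dropD (size s) w) else catD t zeroD.
  rewrite /Gamma (_ : [seq s <- _ | s == mkseq w (size s)] =
    [seq s <- enum_fset g | s == mkseq z (size s)])//.
  apply: eq_in_filter => s sg; rewrite (level_set_size sg s0g); congr (_ == _).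
  apply/eq_in_map => j; rewrite mem_iota => /andP[_]; rewrite add0n => js.
  by rewrite wz// ltn_addr.
rewrite /Gamma; case E : [seq _ <- _ | _] => [//|s l].
have sg : s \in enum_fset g.
  have : s \in [seq s <- enum_fset g | s == mkseq z (size s)] by rewrite E mem_head.
  by rewrite mem_filter => /andP[].
rewrite /catD; case: ifP => // _; rewrite /dropD wz//.
by rewrite (level_set_size sg s0g) ltn_add2l ltnS leq_subr.
Qed.

(** * Bounded families of functionals over the Cantor set *)

Section small_gap.
Variables (R : realType) (E : completeNormedModType R).
Variables (F : Delta -> E -> R) (M : R).
Hypothesis M0 : 0 < M.
Hypothesis linF : forall z, linear (F z : E -> R^o).
Hypothesis leF : forall z u, `|F z u| <= M * `|u|.
Hypothesis contF : forall u, continuous (F ^~ u).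
Hypothesis noell1 : ~ contains_ell1 E.

(** Otherwise each [m] has a [u m] in the unit ball with gap above [e] on every cylinder of length
    [m]. An open set contains such cylinders for all large [m], so [u m] oscillates there by more
    than [e] and crosses one of finitely many thresholds. An independent subsequence then spans
    l1. *)
Lemma small_gap (e : R) : 0 < e -> exists m, forall u, `|u| <= 1 ->
  exists s : m.-tuple bool, `|F (catD s zeroD) u - F (catD s oneD) u| <= e.
Proof.
move=> e0; apply: contrapT => /forallNP H; apply: noell1.
have /choice[u uP] : forall m, exists u, `|u| <= 1 /\ forall s : m.-tuple bool,
    e < `|F (catD s zeroD) u - F (catD s oneD) u|.
  move=> m; have /existsNP[u /not_implyP[u1 /forallNP us]] := H m.
  by exists u; split=> // s; rewrite ltNge; apply/negP; exact: us.
have u1 n : `|u n| <= 1 by case: (uP n).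
(* With mesh [d], the first grid point [p i] above [x] is at most [x + d], so [p i + d] is still
   below any [y > x + 3 * d]. For values in [-M, M] its index is at most the integer part of 2M/d
   plus one, whence [N]. *)
pose d := e / 3.
have d0 : 0 < d by rewrite /d; lra.
pose N := (Num.truncn (2 * M / d)).+2.
pose p (i : 'I_N) := - M + i%:R * d.
pose V (i : 'I_N) n b : set Delta :=
  if b then [set z | p i + d < F z (u n)] else [set z | F z (u n) < p i].
have openV i n b : open (V i n b).
  case: b; rewrite /V.
  - by apply: (@open_comp _ _ (F ^~ (u n)) [set y | p i + d < y]) => [z _|];
    [exact: contF|exact: open_gt].
  - by apply: (@open_comp _ _ (F ^~ (u n)) [set y | y < p i]) => [z _|];
    [exact: contF|exact: open_lt].
have pigeon (x y : R) : - M <= x -> y <= M -> x + e < y ->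
    exists i, x < p i /\ p i + d < y.
  move=> Mx My xy.
  have xM0 : 0 <= (x + M) / d by apply: divr_ge0; lra.
  have /andP[h1 h2] := Num.Theory.truncn_itv xM0.
  have iN : ((Num.truncn ((x + M) / d)).+1 < N)%N.
    rewrite ltnS ltnS; apply: Num.Theory.le_truncn; rewrite ler_pM2r ?invr_gt0//; lra.
  exists (Ordinal iN); rewrite /p /=.
  move: (Num.truncn _) h1 h2 {iN xM0} => k.
  rewrite ler_pdivlMr// ltr_pdivrMr// -natr1 mulrDl mul1r.
  move: (k%:R * d) => kd h1 h2; have dE : 3 * d = e by rewrite /d; lra.
  by split; lra.
have splitV U : open U -> U !=set0 -> \forall n \near \oo, exists i, splits V i n U.
  move=> oU [z Uz]; have [n0 n0P] := Delta_nbhsP (open_nbhs_nbhs (conj oU Uz)).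
  exists n0 => // n /= n0n.
  have Uc w : U (catD (mkseq z n) w).
    by apply: n0P => k kn0; rewrite catD_mkseq_agree// (leq_trans kn0).
  have sz : size (mkseq z n) == n by rewrite size_mkseq.
  have := (uP n).2 (Tuple sz); rewrite /=.
  have Fb w : - M <= F w (u n) <= M.
    by rewrite -ler_norml; apply: le_trans (leF _ _) _; rewrite -[leRHS]mulr1 ler_pM2l.
  set a := catD _ zeroD; set b := catD _ oneD.
  have /andP[a1 a2] := Fb a; have /andP[b1 b2] := Fb b.
  rewrite lter_normr => /orP[h|h].
  - have [i [i1 i2]] := pigeon (F b (u n)) (F a (u n)) b1 a2 ltac:(lra).
    by exists i => -[]; [exists a|exists b]; split=> //; exact: Uc.
  - have [i [i1 i2]] := pigeon (F a (u n)) (F b (u n)) a1 b2 ltac:(lra).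
    by exists i => -[]; [exists b|exists a]; split=> //; exact: Uc.
have [i [n_ nP]] := independent_subsequence openV splitV zeroD.
apply: (independent_contains_ell1 M0 linF leF (u := u \o n_) (p := p i) d0) => [n|n sg].
  exact: u1.
have [z zP] := nP n sg; exists z => j jn.
by have := zP j jn; rewrite /V; case: (sg j).
Qed.
End small_gap.

Definition full_fset (m : nat) : {fset bitseq} :=
  seq_fset tt [seq tval s | s <- enum {: m.-tuple bool}].

Lemma in_full_fset m s : (s \in full_fset m) = (size s == m).
Proof.
rewrite seq_fsetE; apply/mapP/idP => [[t _ ->]|sm]; first by rewrite size_tuple.
by exists (Tuple sm) => //; rewrite mem_enum.
Qed.

Lemma full_fset_neq0 m : full_fset m != fset0.
Proof. by apply/fset0Pn; exists (nseq m false); rewrite in_full_fset size_nseq. Qed.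

Lemma full_fset_size m s s' : s \in full_fset m -> s' \in full_fset m ->
  size s = size s'.
Proof. by rewrite !in_full_fset => /eqP-> /eqP->. Qed.

Definition full_level m := LevelSet (@full_fset_neq0 m) (@full_fset_size m).

(** * Weak-star compact sets are norm bounded *)

Section weak_star.
Variables (R : realType) (E : completeNormedModType R).

Lemma weak_star_linear (f : {ptws E -> R}) : weak_star_dual R E f ->
  linear (f : E -> R^o).
Proof. by move=> [lf _] k u v; exact: lf. Qed.

Lemma ptws_eval_continuous (u : E) : continuous (fun f : {ptws E -> R} => f u).
Proof. exact: (@proj_continuous E (fun=> R) u). Qed.

(** Evaluations are weak-star continuous, so [S] is pointwise bounded, and the uniform boundedness
    principle bounds it on the unit ball; homogeneity does the rest. *)
Lemma weak_star_compact_bounded (S : set {ptws E -> R}) :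
  S `<=` weak_star_dual R E -> compact S ->
  exists M : R, 0 < M /\ forall f, S f -> forall u, `|f u| <= M * `|u|.
Proof.
move=> Sdual cS.
have [||M MP] := @Banach_Steinhauss R E R^o [set f : E -> R^o | S f] _ _ 1.
- move=> f /Sdual fd; split; last exact: weak_star_linear.
  pose lf : {linear E -> R^o} :=
    HB.pack (f : E -> R^o) (GRing.isLinear.Build _ _ _ _ _ (weak_star_linear fd)).
  have /linear_boundedP/pinfty_ex_gt0[r r0 rP] : bounded_near lf (nbhs 0).
    by apply: continuous_linear_bounded; exact: fd.2.
  move=> e; exists (r * e) => x xe; apply: le_trans (rP x) _.
  by rewrite ler_pM2l.
- move=> u.
  have : compact ((fun f : {ptws E -> R} => f u) @` S).
    apply: continuous_compact => //; apply: continuous_subspaceT.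
    exact: ptws_eval_continuous.
  move=> /(@compact_bounded R R^o)/ex_strict_bound_gt0[m m0 mP].
  by exists m => f Sf; apply/ltW/mP; exists f.
exists (`|M| + 1); split; first by rewrite ltr_wpDl.
move=> f Sf u; have [->|u0] := eqVneq u 0.
  by rewrite (linear_fun0 (weak_star_linear (Sdual _ Sf))) !normr0 mulr0.
have n0 : 0 < `|u| by rewrite normr_gt0.
have fZ := linear_funZ (weak_star_linear (Sdual _ Sf)) `|u|^-1 u.
have := MP f Sf (`|u|^-1 *: u).
rewrite normrZ ger0_norm ?invr_ge0// mulVf ?normr_eq0// => /(_ (lexx _)).
rewrite [X in `|X|]fZ normrM ger0_norm ?invr_ge0// mulrC ler_pdivrMr// => h.
apply: le_trans h _; rewrite ler_pM2r//.
by apply: le_trans (ler_norm M) _; rewrite lerDl.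
Qed.
End weak_star.

(** * Convergence along the sets C_x of a basic space *)

Section cofinite.
Variables (T : Type) (D : set T).

(** A limit along this filter is a limit as the points of [D] leave every finite set. *)
Definition cofinite_in : set_system T := [set S | finite_set (D `\` S)].

Global Instance cofinite_in_filter : Filter cofinite_in.
Proof.
split; rewrite /cofinite_in /=.
- by rewrite setDT.
- by move=> P Q /= fP fQ; rewrite classical_sets.setDIr finite_setU.
- by move=> P Q PQ; apply: sub_finite_set; exact: setDS.
Qed.

Lemma cofinite_in_proper : infinite_set D -> ProperFilter cofinite_in.
Proof.
move=> iD; split; last exact: cofinite_in_filter.
by rewrite /cofinite_in /= classical_sets.setD0.
Qed.
End cofinite.

Section basic.
Variable K : basic_space.
Local Notation B := (set_type (bsB K)).
Local Notation Apt := (set_type (bsA K)).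

(** If infinitely many points of C_x avoided [U], the cofinite filter on them would cluster, by
    compactness, at a point of the closure of C_x. Points of C_x are isolated, so they are no
    cluster points, and [x] is none because of [U]. *)
Lemma Cx_almost_nbhs (x : B) (U : set K) : nbhs (\val x : K) U ->
  finite_set (bsCx x `\` U).
Proof.
move=> nU; apply: contrapT => iD; have FF := cofinite_in_proper iD.
have [y [_ cy]] := @bs_compact K _ FF filterT.
have [CA _ clC _] := bs_Cx x.
have FD : cofinite_in (bsCx x `\` U) (bsCx x `\` U).
  by rewrite /cofinite_in /= classical_sets.setDv.
have : closure (bsCx x) y.
  by move=> W Wy; have [z [[Cz _] Wz]] := cy _ _ FD Wy; exists z.
rewrite clC => -[Cy|/= yx].
  have oy : nbhs y [set y] by apply: open_nbhs_nbhs; split=> //; exact/bs_isolated/CA.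
  have [|z [zy] /=] := cy (~` [set y]) _ _ oy; last by [].
  rewrite /cofinite_in /=; apply: sub_finite_set (finite_set1 y).
  by move=> z [_ /contrapT].
have [z [[_ nUz] Uz]] := cy _ U FD (ltac:(by rewrite yx)).
exact: nUz.
Qed.

(** The complement of the closure of C_y is a neighbourhood of [x], hence contains almost all of
    C_x. *)
Lemma Cx_almost_disjoint (x y : B) : x <> y -> finite_set (bsCx x `&` bsCx y).
Proof.
move=> xy; have [_ _ clC _] := bs_Cx y; have [CA _ _ _] := bs_Cx y.
have Ux : nbhs (\val x : K) (~` closure (bsCx y)).
  apply: open_nbhs_nbhs; split; first exact/closed_openC/closed_closure.
  rewrite clC => -[/CA Ax|/= /val_inj//].
  by have := bs_disjAB K; rewrite -subset0 => /(_ (\val x)); apply; split=> //; exact: set_valP.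
apply: sub_finite_set (Cx_almost_nbhs Ux) => z [Cx Cy]; split=> // nC.
by apply: nC; exact: subset_closure.
Qed.

Lemma Aindex_eq (a : Apt) t : bsA_ K t (\val a) -> Aindex a = t.
Proof.
move=> At; rewrite /Aindex; have : bsA_ K (xget [::] [set t | bsA_ K t (\val a)]) (\val a).
  by apply: (@xgetPex _ [::] [set t | bsA_ K t (\val a)]); exists t.
move=> Ai; apply: (@bs_trivIset K) => //.
by exists (\val a).
Qed.

Lemma Lpair_continuous (a : Apt) : continuous (Lpair a : Delta -> Lspc K).
Proof.
move=> z W /Lspc_nbhsE[_ [U nU ->] UW]; apply: filterS nU => w Uw.
by apply: UW; exists w.
Qed.

End basic.

(** * Points of the space over A and over B, and their limits *)

Section L1points.
Variables (R : realType) (K : basic_space).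
Local Notation B := (set_type (bsB K)).
Local Notation Apt := (set_type (bsA K)).

Lemma qD_mem_itv (z : Delta) : qD R z \in (`[0%R, 1%R]%classic : set R).
Proof. by apply/mem_set; rewrite /= in_itv /= qD_itv. Qed.

Definition qI (z : Delta) : unit_segment R := exist _ (qD R z) (qD_mem_itv z).

Lemma qI_continuous : continuous qI.
Proof. by move=> z; apply: set_type_cvg; exact: qD_continuous. Qed.

Definition ApointE (a : Apt) (z : Delta) : Lspc K * {ptws B -> unit_segment R} :=
  (Lpair a z, fun x => qI (gL x (Lpair a z))).

Lemma Apoint_subproof a z : ApointE a z \in @L1set R K.
Proof. by apply/mem_set => x _. Qed.

Definition Apoint a z : L1 R K := exist _ (ApointE a z) (Apoint_subproof a z).

(** The point [x, q(z)]: over [x] only the coordinate at [x] is free, the others being 0. It is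
    parametrised by a sequence so that finite sequences index dyadic intervals of this fibre. *)
Definition BpointE (x : B) (z : Delta) : Lspc K * {ptws B -> unit_segment R} :=
  (LB x, fun y => qI (if y == x then z else zeroD)).

Lemma Bpoint_subproof x z : BpointE x z \in @L1set R K.
Proof.
by apply/mem_set => y /= yx; case: eqP => [yx'|//]; case: yx; rewrite yx'.
Qed.

Definition Bpoint x z : L1 R K := exist _ (BpointE x z) (Bpoint_subproof x z).

Lemma Bpoint_eq x z w : qD R z = qD R w -> Bpoint x z = Bpoint x w.
Proof.
move=> zw; apply: val_inj; congr (_, _); apply/funext => y; apply: val_inj => /=.
by case: ifP.
Qed.

Lemma Bpoint_inj x z w : Bpoint x z = Bpoint x w -> qD R z = qD R w.
Proof.
move=> /(congr1 (fun p : L1 R K => \val ((\val p).2 x))) /=.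
by rewrite eqxx.
Qed.

Lemma gL_continuous (x : B) a : continuous (fun z => gL x (Lpair a z)).
Proof.
move=> z; rewrite /gL; case: `[< bsCx x (\val a) >]; first exact: Gamma_continuous.
exact: cvg_cst.
Qed.

Lemma Apoint_continuous a : continuous (Apoint a).
Proof.
move=> z; apply: set_type_cvg.
apply: (@cvg_pair _ _ _ (nbhs z) (nbhs (Lpair a z)) (nbhs (ApointE a z).2) _ _ _
  (Lpair a) (fun z => (ApointE a z).2)); first exact: Lpair_continuous.
apply: prod_topology_cvg => x /=.
apply: (@continuous_comp _ _ _ (fun z => gL x (Lpair a z)) qI).
  exact: gL_continuous.
exact: qI_continuous.
Qed.

Lemma finite_preimage_val (D : set Apt) (S : set K) :
  (forall a, D a -> S (\val a)) -> finite_set S -> finite_set D.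
Proof.
move=> DS fS; apply: (@sub_finite_set _ _ ((\val : Apt -> K) @^-1` S)) => //.
by apply: finite_preimage => // a b _ _; exact: val_inj.
Qed.

(** The first components converge by [Cx_almost_nbhs]. Every coordinate is eventually equal to its
    limit: at [x] by [Gamma_catD], at [y <> x] because only finitely many points of C_x lie in
    C_y. *)
Lemma Apoint_cvg (x : B) t s z (D : set Apt) :
  (forall a, D a -> bsCx x (\val a) /\ bsA_ K t (\val a)) ->
  s \in level_fset (bspsi x t) ->
  Apoint a (catD s z) @[a --> cofinite_in D] --> Bpoint x (catD t z).
Proof.
move=> DC sg; apply: set_type_cvg.
apply: (@cvg_pair _ _ _ (cofinite_in D) (nbhs (LB x)) (nbhs (BpointE x (catD t z)).2)
  _ _ _ (fun a => Lpair a (catD s z)) (fun a => (ApointE a (catD s z)).2)).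
  move=> W /Lspc_nbhsE[_ [U nU ->] UW]; rewrite /nbhs /= /cofinite_in /=.
  apply: finite_preimage_val (Cx_almost_nbhs nU) => a [/DC[Ca _] nW]; split=> // Ua.
  by apply: nW; apply: UW.
apply: prod_topology_cvg => y /= W /nbhs_singleton Wy.
rewrite /nbhs /= /cofinite_in /=.
have [yx|/eqP yx] := eqVneq y x.
  rewrite yx eqxx in Wy *; rewrite (_ : _ `\` _ = set0)// -subset0 => a [/DC[Ca At]]; apply => /=.
  rewrite /gL asboolT// (Aindex_eq At).
  by rewrite Gamma_catD.
apply: finite_preimage_val (Cx_almost_disjoint (nesym yx)) => a [/DC[Ca At] nW]; split=> //.
apply: contrapT => nCy; apply: nW; rewrite /= /gL asboolF//.
by move: Wy; case: eqP.
Qed.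

End L1points.

(* The adjacent dyadic points q(t0111...) and q(t1000...) agree, so the gaps telescope along
   the 2^n dyadic intervals of level n. *)
Lemma dyadic_gap_eq (R : realType) (phi : Delta -> R) :
  (forall z w, qD R z = qD R w -> phi z = phi w) ->
  (forall t, `|phi (catD t zeroD) - phi (catD t oneD)| <= 4 ^- size t) ->
  phi zeroD = phi oneD.
Proof.
move=> phiq gap.
have gapn n t : `|phi (catD t zeroD) - phi (catD t oneD)| <= 2 ^+ n * 4 ^- (size t + n).
  elim: n t => [|n IH] t; first by rewrite expr0 mul1r addn0.
  have := IH (rcons t false); have := IH (rcons t true).
  rewrite catD_rcons0 catD_rcons1 !size_rcons addSnnS -(phiq _ _ (qD_adjacent R t)) => h1 h2.
  rewrite -(subrK (phi (catD (rcons t false) oneD)) (phi (catD t zeroD))) -addrA.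
  apply: le_trans (ler_normD _ _) _; rewrite exprS -mulrA mulrDl mul1r.
  exact: lerD.
have cat0 z : catD [::] z = z by apply/funext => k; rewrite /catD /= subn0.
apply/eqP; rewrite -subr_eq0 -normr_eq0; apply/eqP/le_anti; rewrite normr_ge0 andbT.
have : (2^-1 : R) ^+ n @[n --> \oo] --> (0 : R).
  by apply: cvg_expr; rewrite ger0_norm ?invr_ge0// invf_lt1// ltr1n.
move=> h; rewrite -(cvg_lim _ h)//; apply: limr_ge; first by apply/cvg_ex; exists 0.
apply: nearW => n; have := gapn n [::]; rewrite !cat0 add0n.
congr (_ <= _); rewrite exprVn (_ : 4 = 2 * 2 :> R); last by rewrite -natrM.
by rewrite exprMn invfM mulrA divff ?mul1r// expf_neq0.
Qed.

(** * Two points that no bounded weak-star continuous family separates *)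

Section main.
Variables (R : realType) (K : basic_space) (E : completeNormedModType R).
Variables (F : L1 R K -> E -> R) (M : R).
Hypothesis M0 : 0 < M.
Hypothesis linF : forall p, linear (F p : E -> R^o).
Hypothesis leF : forall p u, `|F p u| <= M * `|u|.
Hypothesis contF : forall u, continuous (F ^~ u).
Hypothesis noell1 : ~ contains_ell1 E.
Local Notation Apt := (set_type (bsA K)).

(** Only [s] depends on [u]; [g] serves the whole unit ball, so it can index the covering of A_t in
    condition (3). *)
Definition gap_le (e : R) (g : level_set) (a : Apt) := forall u, `|u| <= 1 ->
  exists2 s, s \in level_fset g &
    `|F (Apoint R a (catD s zeroD)) u - F (Apoint R a (catD s oneD)) u| <= e.

Lemma exists_gap_le e a : 0 < e -> exists g, gap_le e g a.
Proof.
move=> e0.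
have cont u : continuous (fun z => F (Apoint R a z) u).
  move=> z; apply: (@continuous_comp _ _ _ (Apoint R a) (F ^~ u)).
    exact: Apoint_continuous.
  exact: contF.
have [m mP] := small_gap (F := fun z => F (Apoint R a z)) M0 (fun z => linF _)
  (fun z => leF _) cont noell1 e0.
exists (full_level m) => u /mP[s sP]; exists (tval s) => //.
by rewrite in_full_fset size_tuple.
Qed.

Lemma Bpoint_gap : exists x, forall u t, `|u| <= 1 ->
  `|F (Bpoint R x (catD t zeroD)) u - F (Bpoint R x (catD t oneD)) u| <= 4 ^- size t.
Proof.
(* Condition (3) concerns subsets of [K], so [k] is quantified back to the unique element of the
   subtype lying over it. *)
pose X g t : set K := [set k | bsA_ K t k /\ forall a, \val a = k -> gap_le (4 ^- size t) g a].
have [x xP] : exists x, forall t, infinite_set (bsCx x `&` X (bspsi x t) t).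
  apply: bs_psi => [g t k [Atk _]|t]; first by exists t.
  apply/seteqP; split=> [k Atk|k [g _ []]//].
  have Ak : bsA K k by exists t.
  have [g gP] := exists_gap_le (exist _ k (mem_set Ak)) (e := 4 ^- size t)
    ltac:(by rewrite invr_gt0 exprn_gt0).
  by exists g => //; split=> // a ak; rewrite (_ : a = exist _ k (mem_set Ak))//; apply: val_inj.
exists x => u t u1.
pose D : set Apt := (fun a => \val a : K) @^-1` (bsCx x `&` X (bspsi x t) t).
have DC a : D a -> bsCx x (\val a) /\ bsA_ K t (\val a) by move=> [? []].
have FD : ProperFilter (cofinite_in D).
  apply: cofinite_in_proper => fD; apply: (xP t).
  apply: sub_finite_set (finite_image (fun a : Apt => \val a : K) fD) => k [Cx Xk].
  have Ak : bsA K k by have [CA _ _ _] := bs_Cx x; exact: CA.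
  by exists (exist _ k (mem_set Ak)).
rewrite leNgt; apply/negP => gap.
set phi0 := F (Bpoint R x (catD t zeroD)) u in gap; set phi1 := F _ u in gap.
have near_gap s : s \in level_fset (bspsi x t) -> cofinite_in D
    [set a | 4 ^- size t < `|F (Apoint R a (catD s zeroD)) u - F (Apoint R a (catD s oneD)) u|].
  move=> sg.
  have c0 : F (Apoint R a (catD s zeroD)) u @[a --> cofinite_in D] --> phi0.
    apply: (@cvg_comp _ _ _ (fun a => Apoint R a (catD s zeroD)) (F ^~ u)); last exact: contF.
    exact: Apoint_cvg.
  have c1 : F (Apoint R a (catD s oneD)) u @[a --> cofinite_in D] --> phi1.
    apply: (@cvg_comp _ _ _ (fun a => Apoint R a (catD s oneD)) (F ^~ u)); last exact: contF.
    exact: Apoint_cvg.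
  have FF := @cofinite_in_filter _ D.
  have cn := cvg_norm (cvgB c0 c1).
  exact: (@cvgr_gt _ _ _ FF _ _ (cn FF FF) _ gap).
(* For a given [a], the [s] provided by [gap_le] is unknown. As [bspsi x t] is finite, some [a] in
   [D] has a large gap at all its elements simultaneously. *)
have near_gaps := filter_bigI FD near_gap.
have DD : cofinite_in D D by rewrite /cofinite_in /= classical_sets.setDv.
have /filter_ex[a [Da aP]] := @filterI _ _ FD _ _ DD near_gaps.
have [_ [_ /(_ a erefl)/(_ u u1)[s sg]]] := Da.
by rewrite leNgt; move/negP; apply; exact: aP.
Qed.

Lemma functionals_not_injective : exists p p', p <> p' /\ F p = F p'.
Proof.
have [x gap] := Bpoint_gap.
exists (Bpoint R x zeroD), (Bpoint R x oneD); split.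
  by move=> /Bpoint_inj /eqP; rewrite qD_zero qD_one eq_sym oner_eq0.
have Fu u : `|u| <= 1 -> F (Bpoint R x zeroD) u = F (Bpoint R x oneD) u.
  move=> u1; apply: (dyadic_gap_eq (phi := fun z => F (Bpoint R x z) u)).
    by move=> z w /Bpoint_eq ->.
  by move=> t; exact: gap.
(* Equality on the unit ball extends to [E] by homogeneity. *)
apply/funext => u; have [u0|u0] := eqVneq u 0.
  by apply: Fu; rewrite u0 normr0.
have nu : `|u| != 0 by rewrite normr_eq0.
have : `| `|u|^-1 *: u| <= 1 by rewrite normrZ ger0_norm ?invr_ge0// mulVf.
by move/Fu; rewrite !(linear_funZ (linF _)) => /mulfI; apply; rewrite invr_eq0.
Qed.
End main.

Theorem theorem1p3 (R : realType) (K : basic_space) :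
  ~ weakly_Radon_Nikodym R (L1 R K).
Proof.
move=> [E [noell1 [S [Sdual cS [h [k [hK _ conth _]]]]]]].
have [M [M0 leM]] := weak_star_compact_bounded Sdual cS.
have hS p : S (\val (h p)) by exact: set_valP.
have [] := @functionals_not_injective R K E (fun p => \val (h p)) M M0.
- by move=> p; exact/weak_star_linear/Sdual.
- by move=> p u; exact: leM.
- move=> u p; apply: (@continuous_comp _ _ _ (fun p => \val (h p) : {ptws E -> R}) (fun f => f u)).
    apply: (@continuous_comp _ _ _ h (set_val : set_type S -> {ptws E -> R})); first exact: conth.
    exact: set_val_continuous.
  exact: ptws_eval_continuous.
- exact: noell1.
move=> p [p' [pp' hpp']]; apply: pp'.
by apply: (can_inj hK); exact: val_inj.
Qed.
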